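(* Properties (P1) and (P2) are different; that is, there exists an infinite-dimensional real Banach space which has property (P2) but does not have property (P1).
   Context: For a Banach space $Z$ with closed unit ball $B_Z$, dual $Z^\ast$ and dual unit sphere $S_{Z^\ast}$, a slice of $B_Z$ is a set of the form $S(z^\ast,\alpha)=\{z\in B_Z\colon z^\ast(z)>1-\alpha\}$ with $z^\ast\in S_{Z^\ast}$ and $\alpha>0$. A convex combination of slices of $B_Z$ is a set of the form $\sum_{i=1}^n\lambda_iS_i=\{\sum_{i=1}^n\lambda_i s_i\colon s_i\in S_i\}$, where $n\in\mathbb{N}$, $\lambda_1,\dotsc,\lambda_n\geq 0$, $\sum_{i=1}^n\lambda_i=1$, and $S_1,\dotsc,S_n$ are slices of $B_Z$. Property (P1) of $Z$: every convex combination of slices of $B_Z$ is open in the relative weak topology of $B_Z$. Property (P2) of $Z$: every convex combination of slices of $B_Z$ has nonempty interior in the relative weak topology of $B_Z$. Property (P1) clearly implies property (P2). *)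

(* Defs.v *)
From mathcomp Require Import all_boot all_order all_algebra.
From mathcomp Require Import all_classical all_reals all_analysis.

Set Implicit Arguments.
Unset Strict Implicit.
Unset Printing Implicit Defensive.
Import Order.TTheory GRing.Theory Num.Theory.
Import numFieldNormedType.Exports.
Local Open Scope classical_set_scope.
Local Open Scope ring_scope.

Section Slices.
Context {R : realType}.
Implicit Types Z : normedModType R.

Definition dual Z : Type := {f : {linear Z -> R^o} | continuous f}.

Definition dual_fun Z (f : dual Z) : Z -> R^o := sval f.
Coercion dual_fun : dual >-> Funclass.

Definition unit_ball Z : set Z := [set z | `|z| <= 1].

(* The set is nonempty and, by continuity of [f], bounded above, so [sup] is
   its genuine supremum. *)
Definition dual_norm Z (f : dual Z) : R := sup [set `|f z| | z in @unit_ball Z].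

(* The carrier [Z] with the coarsest topology making all [f : dual Z]
   continuous. *)
Definition weak Z : topologicalType :=
  @sup_topology Z (dual Z)
    (fun f => Topological.class (initial_topology (dual_fun f))).

(* The topology of [subspace A] makes the points outside [A] isolated; on sets
   contained in [A], such as the convex combinations below, being open and
   having nonempty interior mean the same as in the relative topology of [A]. *)
Definition weak_ball Z : topologicalType :=
  subspace (@unit_ball Z : set (weak Z)).

Definition slice Z (f : dual Z) (alpha : R) : set Z :=
  [set z | unit_ball z /\ 1 - alpha < f z].

Definition is_slice Z (S : set Z) : Prop :=
  exists (f : dual Z) (alpha : R),
    [/\ dual_norm f = 1, 0 < alpha & S = slice f alpha].

Definition sum_sets Z n (lambda : 'I_n -> R) (S : 'I_n -> set Z) : set Z :=
  [set z | exists2 s : 'I_n -> Z,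
     forall i, S i (s i) & z = \sum_(i < n) lambda i *: s i].

Definition convex_combination_of_slices Z (C : set Z) : Prop :=
  exists n (lambda : 'I_n -> R) (S : 'I_n -> set Z),
    [/\ forall i, 0 <= lambda i, \sum_(i < n) lambda i = 1,
        forall i, is_slice (S i) & C = sum_sets lambda S].

Definition P1 Z : Prop :=
  forall C : set Z, convex_combination_of_slices C ->
    open (C : set (weak_ball Z)).

Definition P2 Z : Prop :=
  forall C : set Z, convex_combination_of_slices C ->
    interior (C : set (weak_ball Z)) !=set0.

Definition finite_dimensional Z : Prop :=
  exists n (e : 'I_n -> Z),
    forall z, exists c : 'I_n -> R, z = \sum_(i < n) c i *: e i.

End Slices.

(* Main.v *)
(* The space is the l1-sum of two copies of c0.

   P1 fails: average a slice around e_0 with one around -e_0, both in the first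
   summand.  The result contains 0, but the second components of its elements
   have norm below 1/2, whereas the unit vectors of the second summand lie in
   the ball and tend weakly to 0.

   P2 holds: every functional of norm one gives a slice containing some u_i of
   norm < 1, finitely supported and living in a single summand s(i).  Past all
   these supports and all but a small tail of the functionals, pick a
   coordinate N and put z = sum_i l_i (u_i + e_N), with e_N in the summand s(i);
   then the component z_b has norm L_b = sum_(s(i) = b) l_i, attained at N.  If
   w in the ball is close to z on the coordinates up to N, then |w_b| is almost at
   least L_b, and as sum_b |w_b| <= 1 = sum_b L_b it is almost equal to L_b.
   Write w = sum_i l_i (u_i + t_(s(i))) + d, where t_b is the tail of w_b
   rescaled to have norm at most 1 - kappa.  The remainder satisfies
   |d_b| <= |w_b| - (1 - kappa) L_b, hence |d| <= kappa, so that the points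
   u_i + t_(s(i)) + d stay in the ball and in the given slices. *)

From HB Require Import structures.
Require Import Defs.
From mathcomp Require Import all_boot all_order all_algebra.
From mathcomp Require Import all_classical all_reals all_analysis.
From mathcomp Require Import ring lra.

Set Implicit Arguments.
Unset Strict Implicit.
Unset Printing Implicit Defensive.
Import Order.TTheory GRing.Theory Num.Theory.
Import numFieldNormedType.Exports.
Local Open Scope classical_set_scope.
Local Open Scope ring_scope.

(** * The space c0 *)

(** A boolean predicate rather than a set, so that the module structure of [c0] comes from the
    subtype machinery. *)
Definition null_seq (R : realType) : pred (nat -> R^o) :=
  mem [set u : nat -> R^o | u @ \oo --> (0 : R^o)].

Lemma null_submod_closed (R : realType) : submod_closed (@null_seq R).
Proof.
split; first by rewrite inE /=; exact: cvg_cst.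
move=> a u v; rewrite !inE /= => u0 v0.
have := cvgD (cvgZr (k := a) u0) v0; rewrite scaler0 addr0; exact.
Qed.

HB.instance Definition _ (R : realType) :=
  GRing.isSubmodClosed.Build R (nat -> R^o) (@null_seq R)
    (@null_submod_closed R).

Record c0 (R : realType) := C0 { c0_val :> nat -> R^o; c0P : null_seq c0_val }.

HB.instance Definition _ (R : realType) := [isSub for @c0_val R].
HB.instance Definition _ (R : realType) := [Choice of c0 R by <:].
HB.instance Definition _ (R : realType) :=
  [SubChoice_isSubLmodule of c0 R by <:].

Section c0_norm.
Context {R : realType}.
Implicit Types (u v : c0 R) (n : nat).

Lemma c0_cvg u : (u : nat -> R^o) @ \oo --> (0 : R^o).
Proof. by have := c0P u; rewrite inE. Qed.

Lemma c0D u v n : (u + v) n = u n + v n. Proof. by []. Qed.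
Lemma c0Z (a : R) u n : (a *: u) n = a * u n. Proof. by []. Qed.
Lemma c00 n : (0 : c0 R) n = 0. Proof. by []. Qed.
Lemma c0N u n : (- u) n = - u n. Proof. by []. Qed.

Lemma c0_sum (I : Type) (r : seq I) (P : pred I) (F : I -> c0 R) n :
  (\sum_(i <- r | P i) F i) n = \sum_(i <- r | P i) F i n.
Proof. exact: (big_morph (fun u : c0 R => u n) (fun u v => c0D u v n)). Qed.

Definition c0_norm u : R := sup (range (fun n => `|u n|)).

(** Convergent sequences are bounded, so the [sup] in [c0_norm] is a genuine supremum. *)
Lemma c0_norm_ub u n : `|u n| <= c0_norm u.
Proof.
apply: ub_le_sup; last by exists n.
have [|M [_ /(_ (M + 1))]] := @cvg_seq_bounded _ _ (u : nat -> R^o).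
  by apply/cvg_ex; exists 0; exact: c0_cvg.
by rewrite ltrDl ltr01 => /(_ isT) uM; exists (M + 1) => _ [k _ <-]; exact: uM.
Qed.

Lemma c0_norm_le u (M : R) : (forall n, `|u n| <= M) -> c0_norm u <= M.
Proof.
by move=> uM; apply: ge_sup => [|_ [n _ <-]//]; exists `|u 0%N|; exists 0%N.
Qed.

Lemma c0_normD u v : c0_norm (u + v) <= c0_norm u + c0_norm v.
Proof.
apply: c0_norm_le => n; rewrite c0D (le_trans (ler_normD _ _))//.
by rewrite lerD// c0_norm_ub.
Qed.

Lemma c0_normZ (a : R) u : c0_norm (a *: u) = `|a| * c0_norm u.
Proof.
(* This inequality, used for [a] and again for its inverse, gives both directions. *)
have le (b : R) v : c0_norm (b *: v) <= `|b| * c0_norm v.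
  by apply: c0_norm_le => n; rewrite c0Z normrM ler_wpM2l// c0_norm_ub.
apply/eqP; rewrite eq_le le/=; have [->|a0] := eqVneq a 0.
  by rewrite normr0 mul0r (le_trans _ (c0_norm_ub _ 0))//.
rewrite -ler_pdivlMl ?normr_gt0// -normfV.
by rewrite (le_trans _ (le _ _))// scalerK.
Qed.

Lemma c0_norm_eq0 u : c0_norm u = 0 -> u = 0.
Proof.
move=> u0; apply/val_inj/funext => n /=; apply/eqP.
by rewrite -normr_le0 -u0 c0_norm_ub.
Qed.

HB.instance Definition _ := Lmodule_isNormed.Build R (c0 R)
  c0_normD c0_normZ c0_norm_eq0.

Lemma c0_le_norm u n : `|u n| <= `|u|. Proof. exact: c0_norm_ub. Qed.

Lemma c0_le u (M : R) : (forall n, `|u n| <= M) -> `|u| <= M.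
Proof. exact: c0_norm_le. Qed.

Lemma c0_complete (F : set_system (c0 R)) :
  ProperFilter F -> cauchy F -> cvg F.
Proof.
move=> FF /cauchyP Fc.
have {}Fc e : 0 < e -> exists u : c0 R, \forall v \near F, `|u - v| < e.
  by move=> /Fc[u Fu]; exists u; move: Fu; rewrite -ball_normE.
pose l n : R^o := lim ((fun u : c0 R => u n : R^o) @ F).
have Fl n : (fun u : c0 R => u n : R^o) @ F --> l n.
  apply/cauchy_cvgP/cauchyP => e /Fc[u Fu]; exists (u n : R^o).
  apply: filterS Fu => v uv; rewrite -ball_normE /ball_/=.
  by apply: le_lt_trans uv; rewrite -c0N -c0D; exact: c0_le_norm.
(* The pointwise limit [l] is uniformly close to members of [c0]: pass to the limit along [F] in
   [|u n - v n| < e]. Hence [l] is itself a null sequence. *)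
have Ful e : 0 < e -> exists2 u : c0 R, (forall n, `|u n - l n| <= e) &
    \forall v \near F, `|u - v| < e.
  move=> e0; have [u Fu] := Fc _ e0; exists u => // n.
  have uvl : (fun v : c0 R => `|u n - v n|) @ F --> `|u n - l n|.
    by apply: cvg_norm; apply: cvgB; [exact: cvg_cst|exact: Fl].
  apply: (cvgr_to_le uvl); apply: filterS Fu => v uv.
  by apply: le_trans (ltW uv); rewrite -c0N -c0D; exact: c0_le_norm.
have l0 : null_seq l.
  rewrite inE /=; apply/cvgrPdist_le => e e0.
  have [u ul _] := Ful (e / 2) (divr_gt0 e0 (ltr0Sn _ 1)).
  have /cvgrPdist_le/(_ _ (divr_gt0 e0 (ltr0Sn _ 1))) := c0_cvg u.
  apply: filterS => n; rewrite !sub0r !normrN => un.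
  rewrite -(subrK (u n) (l n)) (splitr e) (le_trans (ler_normD _ _))//.
  by rewrite lerD// distrC.
apply/cvg_ex; exists (C0 l0); apply/cvgrPdist_lt => e e0.
have [u ul Fu] := Ful (e / 2) (divr_gt0 e0 (ltr0Sn _ 1)).
apply: filterS Fu => v uv; rewrite -(subrK u (C0 l0)) -addrA (splitr e).
rewrite (le_lt_trans (ler_normD _ _))// ler_ltD// distrC.
by apply: c0_le => n; rewrite c0D c0N; exact: ul.
Qed.

HB.instance Definition _ := Uniform_isComplete.Build (c0 R) c0_complete.

End c0_norm.

(** * Finite l1-sums *)

(* The alias hides the product topology that [I -> X] carries by default. *)
Definition l1sum (I : finType) (X : Type) : Type := I -> X.

HB.instance Definition _ (R : realType) (I : finType) (X : lmodType R) :=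
  GRing.Lmodule.copy (l1sum I X) (I -> X).

Section l1sum_norm.
Context {R : realType} {I : finType} {X : completeNormedModType R}.
Implicit Types (z w : l1sum I X) (i : I).

Lemma l1D z w i : (z + w) i = z i + w i. Proof. by []. Qed.
Lemma l1Z (a : R) z i : (a *: z) i = a *: z i. Proof. by []. Qed.
Lemma l1N z i : (- z) i = - z i. Proof. by []. Qed.

Lemma l1_sum (J : Type) (r : seq J) (P : pred J) (F : J -> l1sum I X) i :
  (\sum_(j <- r | P j) F j) i = \sum_(j <- r | P j) F j i.
Proof.
exact: (big_morph (fun z : l1sum I X => z i) (fun z w => l1D z w i)).
Qed.

Definition l1_norm z : R := \sum_i `|z i|.

Lemma l1_normD z w : l1_norm (z + w) <= l1_norm z + l1_norm w.
Proof. by rewrite -big_split ler_sum// => i _; rewrite l1D ler_normD. Qed.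

Lemma l1_normZ (a : R) z : l1_norm (a *: z) = `|a| * l1_norm z.
Proof. by rewrite mulr_sumr; apply: eq_bigr => i _; rewrite l1Z normrZ. Qed.

Lemma l1_norm_eq0 z : l1_norm z = 0 -> z = 0.
Proof.
move=> /psumr_eq0P z0; apply/funext => i; apply/eqP.
by rewrite -normr_eq0 z0.
Qed.

HB.instance Definition _ := Lmodule_isNormed.Build R (l1sum I X)
  l1_normD l1_normZ l1_norm_eq0.

Lemma l1_normE z : `|z| = \sum_i `|z i|. Proof. by []. Qed.

Lemma l1_le_norm z i : `|z i| <= `|z|.
Proof. by rewrite l1_normE (bigD1 i)//= lerDl sumr_ge0. Qed.

Lemma l1_complete (F : set_system (l1sum I X)) :
  ProperFilter F -> cauchy F -> cvg F.
Proof.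
move=> FF /cauchyP Fc.
have Fi i : cvg ((fun z : l1sum I X => z i : X) @ F).
  apply/cauchy_cvgP/cauchyP => e /Fc[u]; rewrite -ball_normE => Fu.
  exists (u i); rewrite -ball_normE.
  apply: (@filterS _ F _ (ball_ Num.norm u e)) Fu => v /= uv.
  by apply: le_lt_trans uv; rewrite -(l1N v i) -(l1D u); exact: l1_le_norm.
pose l : l1sum I X := fun i => lim ((fun z : l1sum I X => z i : X) @ F).
apply/cvg_ex; exists l; apply/cvgrPdist_lt => e e0.
(* The successor covers an empty [I] and keeps the final sum strictly below [e]. *)
have d0 : 0 < e / (#|I|.+1)%:R by rewrite divr_gt0.
have : \forall z \near F, forall i, `|l i - z i| < e / (#|I|.+1)%:R.
  apply: filter_forall => i.
  by move/cvgrPdist_lt: (Fi i); exact.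
apply: filterS => z zl; rewrite l1_normE.
apply: (@le_lt_trans _ _ (\sum_(i : I) (e / (#|I|.+1)%:R))).
  by apply: ler_sum => i _; rewrite l1D l1N; exact/ltW.
rewrite sumr_const -(mulr_natr (e / _)) mulrAC ltr_pdivrMr// ltr_pM2l// ltr_nat.
by rewrite ltnS cardE.
Qed.

HB.instance Definition _ := Uniform_isComplete.Build (l1sum I X) l1_complete.

End l1sum_norm.

(** * Dual space and weak topology *)

Section dual_space.
Context {R : realType} {Z : normedModType R}.
Implicit Types (f : dual Z) (z w : Z).

Lemma dualD f z w : f (z + w) = f z + f w.
Proof. exact: (linearD (sval f)). Qed.

Lemma dualZ f (a : R) z : f (a *: z) = a * f z.
Proof. exact: (linearZ_LR (sval f)). Qed.

Lemma dualN f z : f (- z) = - f z.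
Proof. exact: (linearN (sval f)). Qed.

Lemma dual0 f : f 0 = 0.
Proof. exact: (linear0 (sval f)). Qed.

Lemma dual_sum f (J : Type) (r : seq J) (P : pred J) (F : J -> Z) :
  f (\sum_(j <- r | P j) F j) = \sum_(j <- r | P j) f (F j).
Proof. exact: (linear_sum (sval f)). Qed.

Lemma dual_has_sup f : has_sup [set `|f z| | z in @unit_ball R Z].
Proof.
split; first by exists `|f 0|; exists 0 => //; rewrite /unit_ball/= normr0.
have /linear_boundedP [r [_ /(_ (r + 1))]] :=
  continuous_linear_bounded 0 (svalP f 0).
rewrite ltrDl ltr01 => /(_ isT) fr; exists `|r + 1| => _ [z z1 <-].
rewrite (le_trans (fr z))// (le_trans (ler_norm _))// normrM normr_id.
by rewrite ler_piMr.
Qed.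

Lemma dual_norm_ge0 f : 0 <= dual_norm f.
Proof.
rewrite (le_trans (normr_ge0 (f 0)))//; apply: sup_ubound => [|/=].
  by have [] := dual_has_sup f.
by exists 0 => //; rewrite /unit_ball/= normr0.
Qed.

Lemma dual_le_norm f z : `|f z| <= dual_norm f * `|z|.
Proof.
have [->|z0] := eqVneq z 0; first by rewrite dual0 !normr0 mulr0.
have z1 : 0 < `|z| by rewrite normr_gt0.
rewrite -ler_pdivrMr//; apply: sup_ubound => [|/=].
  by have [] := dual_has_sup f.
exists (`|z|^-1 *: z); last by rewrite dualZ normrM normfV normr_id mulrC.
by rewrite /unit_ball/= normrZ normfV normr_id mulVf ?gt_eqF.
Qed.

Lemma dual_norm_eq1 f z :
  (forall w, `|f w| <= `|w|) -> `|z| <= 1 -> f z = 1 -> dual_norm f = 1.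
Proof.
move=> fle z1 fz; apply/eqP; rewrite eq_le; apply/andP; split.
  apply: ge_sup => [|_ [w w1 <-]]; first by exists `|f z|; exists z.
  exact: le_trans (fle w) w1.
have := le_trans (ler_norm _) (dual_le_norm f z).
by rewrite fz => /le_trans; apply; rewrite ler_piMr ?dual_norm_ge0.
Qed.

Lemma dual_norm_adherent f (e : R) : 0 < e ->
  exists2 z, `|z| <= 1 & dual_norm f - e < f z.
Proof.
move=> e0; have [_ [z z1 <-] fz] := sup_adherent e0 (dual_has_sup f).
(* The supremum is over absolute values; passing to [- z] if necessary fixes the sign. *)
have [f0|f0] := leP 0 (f z); first by exists z => //; rewrite -(ger0_norm f0).
by exists (- z); rewrite ?normrN// dualN -(ltr0_norm f0).
Qed.

Lemma weak_near f z (e : R) : 0 < e ->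
  \forall w \near (z : weak Z), `|f z - f w| < e.
Proof.
move=> e0; have /cvg_sup/(_ f) : nbhs (z : weak Z) --> (z : weak Z) by [].
move=> /(_ [set w | `|f z - f w| < e]); apply.
have := @initial_continuous _ _ (dual_fun f) z.
by move=> /cvgrPdist_lt; exact.
Qed.

Lemma weak_cvg (u : nat -> Z) z :
  (forall f, (fun n => f (u n)) @ \oo --> f z) -> u @ \oo --> (z : weak Z).
Proof.
move=> uz; apply/cvg_sup => f A.
rewrite nbhsE => -[_ [[B oB <-] Bz] BA].
have : nbhs (f z) B by rewrite nbhsE; exists B.
move=> /(uz f) [N _ uB]; exists N => // n Nn; exact: (BA _ (uB n Nn)).
Qed.

(** The centre must lie in the ball, because the subspace topology isolates all other points. *)
Lemma weak_ball_nbhsP z (C : set Z) : unit_ball z ->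
  nbhs (z : weak_ball Z) C <->
  \forall w \near (z : weak Z), unit_ball (w : Z) -> C w.
Proof.
move=> z1; have E := @nbhs_subspace_in (weak Z) (@unit_ball R Z) z z1.
by split; rewrite /nbhs/= -E.
Qed.

Section bounded_functional.
Variables (phi : {linear Z -> R^o}) (M : R).
Hypothesis phi_le : forall z, `|phi z| <= M * `|z|.

Lemma bounded_functional_continuous : continuous phi.
Proof.
apply/linear_bounded_continuous/linear_boundedP.
exists M; split; first exact: num_real.
by move=> r Mr z; rewrite (le_trans (phi_le z))// ler_wpM2r// ltW.
Qed.

Definition bounded_dual : dual Z := exist _ phi bounded_functional_continuous.

Lemma bounded_dualE z : bounded_dual z = phi z. Proof. by []. Qed.

End bounded_functional.
End dual_space.

(** * Functionals on c0 and on l1-sums of c0 *)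

Section c0_truncation.
Context {R : realType}.
Implicit Types (u w : c0 R) (N n k : nat).

Lemma null_seq_finite (a : nat -> R^o) N :
  (forall k, (N <= k)%N -> a k = 0) -> null_seq a.
Proof.
move=> a0; rewrite inE /=; apply: cvg_near_cst.
by apply: filterS (nbhs_infty_ge N) => k /a0 ->.
Qed.

Fact c0_head_subproof N u :
  null_seq (fun k => if (k < N)%N then u k else 0 : R^o).
Proof. by apply: (@null_seq_finite _ N) => k; rewrite leqNgt => /negPf ->. Qed.

Definition c0_head N u : c0 R := C0 (c0_head_subproof N u).

Fact c0_unit_subproof n : null_seq (fun k => (k == n)%:R : R^o).
Proof. by apply: (@null_seq_finite _ n.+1) => k /gtn_eqF ->. Qed.

Definition c0_unit n : c0 R := C0 (c0_unit_subproof n).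

Lemma c0_unitE n k : c0_unit n k = (k == n)%:R.
Proof. by []. Qed.

Lemma norm_c0_unit n : `|c0_unit n| = 1.
Proof.
apply/eqP; rewrite eq_le; apply/andP; split.
  by apply: c0_le => k; rewrite c0_unitE normr_nat lern1 leq_b1.
by apply: le_trans (c0_le_norm _ n); rewrite c0_unitE eqxx normr1.
Qed.

Lemma c0_head_near u (e : R) : 0 < e ->
  \forall N \near \oo, `|u - c0_head N u| <= e.
Proof.
move=> e0; have /cvgrPdist_le/(_ _ e0)[N _ uN] := c0_cvg u.
apply: filterS (nbhs_infty_ge N) => M NM; apply: c0_le => k.
rewrite c0D c0N /=; case: ltnP => Mk; first by rewrite subrr normr0 ltW.
rewrite subr0 -normrN -sub0r; exact: (uN k (leq_trans NM Mk)).
Qed.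

(** The supports are disjoint, so the sup norm of the sum is the larger of the two norms. *)
Lemma c0_headD_le u w N (M : R) : `|u| <= M -> `|w| <= M ->
  (forall k, (k < N)%N -> w k = 0) -> `|c0_head N u + w| <= M.
Proof.
move=> uM wM w0; apply: c0_le => k; rewrite c0D /=; case: ltnP => kN.
  by rewrite w0// addr0 (le_trans (c0_le_norm _ _)).
by rewrite add0r (le_trans (c0_le_norm _ _)).
Qed.

(* A head [x] nearly attaining the norm of [f] leaves no room for [f] on the
   tail: [x + w] and [x - w] stay in the ball when [w] does. *)
Lemma c0_dual_tail (f : dual (c0 R)) (e : R) : 0 < e ->
  \forall N \near \oo, forall w, (forall k, (k < N)%N -> w k = 0) ->
    `|f w| <= e * `|w|.
Proof.
move=> e0; have e2 : 0 < e / 2 by rewrite divr_gt0.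
have [x x1 fx] := dual_norm_adherent f e2.
have D0 := dual_norm_ge0 f.
(* At this distance, replacing [x] by its head costs [f] at most [e / 2]; the [+ 1] avoids dividing
   by zero. *)
have d0 : 0 < e / 2 / (dual_norm f + 1) by rewrite divr_gt0// ltr_wpDl.
apply: filterS (c0_head_near x d0) => N xN w w0.
have fxN : dual_norm f - e <= f (c0_head N x).
  have : `|f (x - c0_head N x)| <= e / 2.
    rewrite (le_trans (dual_le_norm _ _))//.
    rewrite (le_trans (ler_wpM2l D0 xN))// mulrCA ler_piMr// ?ltW//.
    by rewrite ltr_pdivrMr ?mul1r ?ltrDl// ltr_wpDl.
  by rewrite dualD dualN ler_norml => /andP[_]; lra.
have [->|wn0] := eqVneq w 0; first by rewrite dual0 !normr0 mulr0.
have w1 : 0 < `|w| by rewrite normr_gt0.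
have unit_w (v : c0 R) : `|v| <= 1 -> (forall k, (k < N)%N -> v k = 0) ->
    f v <= e.
  move=> v1 v0; have := dual_le_norm f (c0_head N x + v).
  have := ler_wpM2l D0 (c0_headD_le x1 v1 v0); rewrite mulr1 dualD.
  move=> /[swap] /le_trans /[apply]; rewrite ler_norml => /andP[_]; lra.
pose v := `|w|^-1 *: w.
have v1 : `|v| <= 1 by rewrite normrZ normfV normr_id mulVf ?gt_eqF.
have v0 k : (k < N)%N -> v k = 0 by move=> kN; rewrite c0Z w0// mulr0.
have fv : `|f v| <= e.
  rewrite ler_norml lerNl -dualN !unit_w// ?normrN// => k kN.
  by rewrite c0N v0 ?oppr0.
have wv : w = `|w| *: v by rewrite scalerA divff ?gt_eqF// scale1r.
by rewrite {1}wv dualZ normrM normr_id mulrC ler_pM2r.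
Qed.

End c0_truncation.

(** * Summands of an l1-sum and restrictions of functionals to them *)

Section l1_injection.
Context {R : realType} {I : finType} {X : completeNormedModType R}.
Implicit Types (i j : I) (x y : X) (z : l1sum I X).

Definition l1_inj i x : l1sum I X := fun j => if j == i then x else 0.

Lemma l1_injE i x j : l1_inj i x j = if j == i then x else 0.
Proof. by []. Qed.

Fact l1_inj_linear i : linear (l1_inj i).
Proof.
move=> a x y; apply/funext => j; rewrite l1D l1Z !l1_injE.
by case: eqP => // _; rewrite scaler0 addr0.
Qed.

HB.instance Definition _ i :=
  GRing.isLinear.Build R X (l1sum I X) _ (l1_inj i) (l1_inj_linear i).

Lemma norm_l1_inj i x : `|l1_inj i x| = `|x|.
Proof.
rewrite l1_normE (bigD1 i)//= l1_injE eqxx big1 ?addr0// => j ji.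
by rewrite l1_injE (negPf ji) normr0.
Qed.

Lemma l1_inj_sum z : z = \sum_i l1_inj i (z i).
Proof.
apply/funext => j; rewrite l1_sum (bigD1 j)//= l1_injE eqxx big1 ?addr0//.
by move=> i ij; rewrite l1_injE eq_sym (negPf ij).
Qed.

Fact dual_comp_subproof (f : dual (l1sum I X)) i x :
  `|(sval f \o l1_inj i) x| <= dual_norm f * `|x|.
Proof. by rewrite -(norm_l1_inj i); exact: dual_le_norm. Qed.

Definition dual_comp (f : dual (l1sum I X)) i : dual X :=
  bounded_dual (dual_comp_subproof f i).

Lemma dual_compE f i x : dual_comp f i x = f (l1_inj i x).
Proof. by []. Qed.

Lemma dual_l1_sum (f : dual (l1sum I X)) z :
  f z = \sum_i dual_comp f i (z i).
Proof. by rewrite {1}(l1_inj_sum z) dual_sum. Qed.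

(* If every component were at most [1 - a] times its norm, so would be [f]. *)
Lemma slice_comp (f : dual (l1sum I X)) (a : R) : dual_norm f = 1 -> 0 < a ->
  exists i x, `|x| < 1 /\ 1 - a < dual_comp f i x.
Proof.
(* Capping [a] at 1 makes [1 - b] nonnegative, so that it can multiply norm inequalities and [F]
   below is positive. *)
move=> f1 a0; pose b := Num.min a 1.
have b0 : 0 < b by rewrite lt_min a0 ltr01.
have b1 : 0 <= 1 - b by rewrite subr_ge0 ge_min lexx orbT.
suff [i [x [x1 fx]]] : exists i x, `|x| < 1 /\ 1 - b < dual_comp f i x.
  exists i, x; split => //; apply: le_lt_trans fx.
  by rewrite lerD2l lerN2 ge_min lexx.
have [z z1 fz] := dual_norm_adherent f b0; rewrite f1 in fz.
have [i fi] : exists i, (1 - b) * `|z i| < dual_comp f i (z i).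
  apply/existsP; apply: contraLR fz => /existsPn fi; rewrite -leNgt dual_l1_sum.
  apply: (@le_trans _ _ (\sum_i (1 - b) * `|z i|)).
    by apply: ler_sum => i _; rewrite leNgt.
  by rewrite -mulr_sumr -l1_normE ler_piMr.
have zi0 : 0 < `|z i|.
  rewrite normr_gt0; apply: contraTneq fi => ->.
  by rewrite dual0 normr0 mulr0 ltxx.
pose v := `|z i|^-1 *: z i; pose F := dual_comp f i v.
have v1 : `|v| = 1 by rewrite normrZ normfV normr_id mulVf ?gt_eqF.
have fv : 1 - b < F by rewrite /F dualZ mulrC ltr_pdivlMr.
have F0 : 0 < F by exact: le_lt_trans fv.
(* The midpoint of [(1 - b) / F] and 1: below 1, yet [c * F] still exceeds [1 - b]. *)
pose c := ((1 - b) / F + 1) / 2.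
have cge0 : 0 <= c by rewrite divr_ge0// addr_ge0// divr_ge0// ltW.
have c1 : c < 1.
  rewrite /c ltr_pdivrMr// mul1r -ltrBrDr -addrA subrr addr0.
  by rewrite ltr_pdivrMr// mul1r.
exists i, (c *: v); split.
  by rewrite normrZ v1 mulr1 ger0_norm.
rewrite dualZ -/F /c mulrAC mulrDl divfK ?gt_eqF// mul1r ltr_pdivlMr//; lra.
Qed.

End l1_injection.

(** * Tails, slices and coordinates in l1-sums of copies of c0 *)

Section l1_c0.
Context {R : realType} {I : finType}.
Local Notation Z := (l1sum I (c0 R)).
Implicit Types (f : dual Z) (z w : Z) (i : I).

Lemma l1_c0_dual_tail f (e : R) : 0 < e ->
  \forall N \near \oo, forall w, (forall i k, (k < N)%N -> w i k = 0) ->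
    `|f w| <= e * `|w|.
Proof.
move=> e0; have : \forall N \near \oo, forall i (u : c0 R),
    (forall k, (k < N)%N -> u k = 0) -> `|dual_comp f i u| <= e * `|u|.
  by apply: filter_forall => i; exact: c0_dual_tail.
apply: filterS => N fN w w0; rewrite dual_l1_sum l1_normE mulr_sumr.
by rewrite (le_trans (ler_norm_sum _ _ _))// ler_sum// => i _; exact: fN (w0 i).
Qed.

(** Truncating the vector from [slice_comp] does not increase its norm, and a late truncation uses
    at most half of the margin over [1 - a]. *)
Lemma slice_c0_comp f (a : R) : dual_norm f = 1 -> 0 < a ->
  exists i (u : c0 R), [/\ `|u| < 1, 1 - a < dual_comp f i u &
    \forall N \near \oo, forall k, (N <= k)%N -> u k = 0].
Proof.
move=> f1 a0; have [i [x [x1 fx]]] := slice_comp f1 a0.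
have e0 : 0 < (dual_comp f i x - (1 - a)) / 2.
  by rewrite divr_gt0// subr_gt0.
have [N xN] := filter_ex (c0_head_near x e0).
exists i, (c0_head N x); split.
- by apply: le_lt_trans x1; apply: c0_le => k /=; case: ifP => _;
    rewrite ?normr0// c0_le_norm.
- have : `|dual_comp f i (x - c0_head N x)| <= (dual_comp f i x - (1 - a)) / 2.
    apply: le_trans xN; rewrite dual_compE (le_trans (dual_le_norm _ _))//.
    by rewrite f1 mul1r norm_l1_inj.
  rewrite dualD dualN ler_norml => /andP[_]; lra.
- apply: filterS (nbhs_infty_ge N) => M NM k Mk /=.
  by rewrite ltnNge (leq_trans NM Mk).
Qed.

Definition c0_coord_fun i k z : R^o := z i k.

Fact c0_coord_linear i k : linear (c0_coord_fun i k).
Proof. by []. Qed.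

HB.instance Definition _ i k :=
  GRing.isLinear.Build R Z R^o _ (c0_coord_fun i k) (c0_coord_linear i k).

Fact c0_coord_subproof i k z : `|c0_coord_fun i k z| <= 1 * `|z|.
Proof. by rewrite mul1r (le_trans (c0_le_norm _ _))// l1_le_norm. Qed.

Definition c0_coord i k : dual Z := bounded_dual (c0_coord_subproof i k).

Lemma c0_coordE i k z : c0_coord i k z = z i k. Proof. by []. Qed.

(** Only finitely many coordinate functionals are involved. The range includes [N] itself, where the
    spike will sit. *)
Lemma weak_near_coords z N (e : R) : 0 < e ->
  \forall w \near (z : weak Z),
    forall i k, (k <= N)%N -> `|z i k - (w : Z) i k| < e.
Proof.
move=> e0.
have zi i (k : 'I_N.+1) :
    nbhs (z : weak Z) [set w | `|z i k - (w : Z) i k| < e].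
  exact: (weak_near (c0_coord i k) z e0).
have F : Filter (nbhs (z : weak Z)) := nbhs_filter (z : weak Z).
have zN := filter_forall F (fun i => filter_forall F (zi i)).
apply: filterS zN => w wz i k; rewrite -ltnS => kN.
exact: (wz i (Ordinal kN)).
Qed.

End l1_c0.

(** * Interior of convex combinations of slices *)

Section decomposition.
Context {R : realType} {I : finType}.
Local Notation Z := (l1sum I (c0 R)).
Variables (n : nat) (lambda : 'I_n -> R) (sigma : 'I_n -> I).
Hypothesis lambda_ge0 : forall i, 0 <= lambda i.
Hypothesis lambda_sum : \sum_i lambda i = 1.

Definition inj_comb (v : 'I_n -> c0 R) : Z :=
  \sum_i lambda i *: l1_inj (sigma i) (v i).

(** The [L_b] of the overview. *)
Definition comp_weight b : R := \sum_(i | sigma i == b) lambda i.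

Lemma inj_combE v b k :
  inj_comb v b k = \sum_(i | sigma i == b) lambda i * v i k.
Proof.
rewrite /inj_comb l1_sum c0_sum [RHS]big_mkcond; apply: eq_bigr => i _.
rewrite l1Z c0Z l1_injE eq_sym; case: ifP => // _.
by rewrite c00 mulr0.
Qed.

Lemma comp_weight_ge0 b : 0 <= comp_weight b.
Proof. by rewrite sumr_ge0. Qed.

Lemma comp_weight_sum : \sum_b comp_weight b = 1.
Proof. by rewrite -lambda_sum (partition_big sigma xpredT). Qed.

Lemma comp_weight0 b i : comp_weight b = 0 -> sigma i == b -> lambda i = 0.
Proof. by move=> /psumr_eq0P; apply. Qed.

Lemma norm_inj_comb_le v (M : R) : (forall i, `|v i| <= M) ->
  `|inj_comb v| <= M.
Proof.
move=> vM; rewrite (le_trans (ler_norm_sum _ _ _))// -[M]mul1r -lambda_sum.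
rewrite mulr_suml ler_sum// => i _.
by rewrite normrZ ger0_norm// norm_l1_inj ler_wpM2l.
Qed.

Variables (u : 'I_n -> c0 R) (N : nat) (kappa delta : R).
Hypothesis kappa_gt0 : 0 < kappa.
Hypothesis u_le : forall i, `|u i| <= 1 - kappa.
Hypothesis u_head : forall i k, (N <= k)%N -> u i k = 0.
(** One [delta] pays for the error at the spike, the other remains as a lower bound for [excess].
    Components of weight 0 are exempt, since no positive [delta] would satisfy the bound there. *)
Hypothesis delta_le :
  forall b, 0 < comp_weight b -> delta + delta <= kappa * comp_weight b.

(* The coordinate [N] of the component [b] is exactly [comp_weight b]: any [w]
   weakly close to [spiked] has [`|w b|] almost at least [comp_weight b]. *)
Definition spiked : Z := inj_comb (fun i => u i + c0_unit N).

Lemma spiked_head b k : (k < N)%N ->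
  spiked b k = \sum_(i | sigma i == b) lambda i * u i k.
Proof.
move=> kN; rewrite inj_combE; apply: eq_bigr => i _.
by rewrite c0D c0_unitE ltn_eqF// addr0.
Qed.

Lemma spiked_spike b : spiked b N = comp_weight b.
Proof.
rewrite inj_combE; apply: eq_bigr => i _.
by rewrite c0D u_head// add0r c0_unitE eqxx mulr1.
Qed.

(** The spike lies outside the support of [u i], so adding it keeps the norm at most 1. *)
Lemma norm_spiked_le : `|spiked| <= 1.
Proof.
apply: norm_inj_comb_le => i; apply: c0_le => k; rewrite c0D c0_unitE.
case: eqP => [->|_]; first by rewrite u_head// add0r normr1.
rewrite addr0 (le_trans (c0_le_norm _ _))// (le_trans (u_le i))//.
by rewrite gerBl ltW.
Qed.

Variable w : Z.
Hypothesis w_near : forall b k, (k <= N)%N -> `|spiked b k - w b k| < delta.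

Let rho b := `|w b|.
(** The norm allowed to the remainder in component [b]; summed over [b] it gives
    [|w| - (1 - kappa)]. *)
Let excess b := rho b - (1 - kappa) * comp_weight b.
(** When [rho b = 0] the division returns 0, and so the tail is 0. *)
Let tail b : c0 R := ((1 - kappa) / rho b) *: (w b - c0_head N (w b)).
Let rest : Z := w - inj_comb (fun i => u i + tail (sigma i)).

Let tailE b k :
  tail b k = if (k < N)%N then 0 else (1 - kappa) / rho b * w b k.
Proof.
rewrite c0Z c0D c0N /=; case: ltnP => _; last by rewrite subr0.
by rewrite subrr mulr0.
Qed.

(** The weights sum to 1, so some index [i] exists, and [0 <= |u i| <= 1 - kappa]. *)
Let kappa_le1 : kappa <= 1.
Proof.
have [i _|I0] := pickP (fun i : 'I_n => true).
  by have := le_trans (normr_ge0 _) (u_le i); rewrite subr_ge0.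
move: lambda_sum; rewrite big_pred0// => /eqP.
by rewrite eq_sym oner_eq0.
Qed.

Let norm_tail_le b : `|tail b| <= 1 - kappa.
Proof.
have k1 : 0 <= 1 - kappa by rewrite subr_ge0.
apply: c0_le => k; rewrite tailE; case: ltnP => _; first by rewrite normr0.
have [r0|r0] := eqVneq (rho b) 0; first by rewrite r0 invr0 mulr0 mul0r normr0.
have r1 : 0 < rho b by rewrite /rho normr_gt0 -normr_eq0.
rewrite normrM (ger0_norm (divr_ge0 k1 (ltW r1))) mulrAC ler_pdivrMr//.
by rewrite ler_wpM2l// c0_le_norm.
Qed.

Let norm_uD_tail_le i : `|u i + tail (sigma i)| <= 1 - kappa.
Proof.
apply: c0_le => k; rewrite c0D tailE; case: ltnP => kN.
  by rewrite addr0 (le_trans (c0_le_norm _ _)).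
rewrite u_head// add0r; have := c0_le_norm (tail (sigma i)) k.
by rewrite tailE ltnNge kN /= => /le_trans; apply.
Qed.

(** The spike forces [rho b >= w b N > comp_weight b - delta], so [excess b] is more than
    [kappa * comp_weight b - delta]. *)
Let delta_le_excess b : 0 < comp_weight b -> delta <= excess b.
Proof.
move=> b0; have := delta_le b0.
have := le_lt_trans (ler_norm _) (w_near b (leqnn N)).
have := le_trans (ler_norm _) (c0_le_norm (w b) N).
rewrite spiked_spike /excess -/(rho b); lra.
Qed.

Let excess_ge0 b : 0 <= excess b.
Proof.
have [b0|b0] := eqVneq (comp_weight b) 0.
  by rewrite /excess b0 mulr0 subr0 normr_ge0.
have d0 : 0 <= delta := le_trans (normr_ge0 _) (ltW (w_near b (leqnn N))).
apply: le_trans d0 (delta_le_excess _).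
by rewrite lt_neqAle eq_sym b0 comp_weight_ge0.
Qed.

Let rest_head b k : (k < N)%N -> rest b k = w b k - spiked b k.
Proof.
move=> kN; rewrite /rest l1D c0D l1N c0N inj_combE spiked_head//; congr (_ - _).
by apply: eq_bigr => i _; rewrite c0D tailE kN addr0.
Qed.

Let rest_tail b k : (N <= k)%N ->
  rest b k = w b k - comp_weight b * ((1 - kappa) / rho b * w b k).
Proof.
move=> kN; rewrite /rest l1D c0D l1N c0N inj_combE; congr (_ - _).
rewrite mulr_suml; apply: eq_bigr => i /eqP ib.
by rewrite c0D tailE ltnNge kN u_head// add0r ib.
Qed.

(** Below [N] the remainder is [w - spiked], smaller than [delta], or just [w b] if the weight is 0.
    From [N] on it is [w b] rescaled from norm [rho b] to norm [excess b]. *)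
Let norm_rest_comp_le b : `|rest b| <= excess b.
Proof.
apply: c0_le => k; have [kN|kN] := ltnP k N.
  rewrite rest_head//; have [b0|b0] := eqVneq (comp_weight b) 0.
    rewrite spiked_head// big1 ?subr0 => [|i ib].
      by rewrite /excess b0 mulr0 subr0 c0_le_norm.
    by rewrite (comp_weight0 b0 ib) mul0r.
  rewrite distrC (le_trans (ltW (w_near b (ltnW kN))))//.
  by apply: delta_le_excess; rewrite lt_neqAle eq_sym b0 comp_weight_ge0.
rewrite rest_tail//; have wk := c0_le_norm (w b) k.
have [r0|r0] := eqVneq (rho b) 0.
  by rewrite r0 invr0 mulr0 mul0r mulr0 subr0 (le_trans wk)// -/(rho b) r0.
have r1 : 0 < rho b by rewrite /rho normr_gt0 -normr_eq0.
have -> : w b k - comp_weight b * ((1 - kappa) / rho b * w b k) =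
    excess b * (w b k / rho b) by rewrite /excess; field.
rewrite normrM ger0_norm// ler_piMr// normrM normfV normr_id.
by rewrite ler_pdivrMr// mul1r.
Qed.

Lemma spiked_decomposition : exists (t : I -> c0 R) (d : Z),
  [/\ w = inj_comb (fun i => u i + t (sigma i)) + d,
      `|d| <= `|w| - (1 - kappa),
      forall i, `|u i + t (sigma i)| <= 1 - kappa,
      forall b, `|t b| <= 1 - kappa &
      forall b k, (k < N)%N -> t b k = 0].
Proof.
exists tail, rest; split => //.
- by rewrite /rest addrC subrK.
- have -> : 1 - kappa = \sum_b (1 - kappa) * comp_weight b.
    by rewrite -mulr_sumr comp_weight_sum mulr1.
  by rewrite !l1_normE -sumrB ler_sum// => b _; exact: norm_rest_comp_le.
- by move=> b k kN; rewrite tailE kN.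
Qed.

End decomposition.

(** * Property (P2) for finite l1-sums of c0 *)

Lemma l1_c0_P2 (R : realType) (I : finType) : P2 (l1sum I (c0 R)).
Proof.
move=> C [n [lambda [S [lambda_ge0 lambda_sum slS ->]]]].
have /choice[p Sp] i : exists q : dual (l1sum I (c0 R)) * R * (I * c0 R),
    [/\ S i = slice q.1.1 q.1.2, dual_norm q.1.1 = 1, `|q.2.2| < 1,
      1 - q.1.2 < dual_comp q.1.1 q.2.1 q.2.2 &
      \forall N \near \oo, forall k, (N <= k)%N -> q.2.2 k = 0].
  have [f [a [f1 a0 ->]]] := slS i.
  have [b [u [u1 fu u0]]] := slice_c0_comp f1 a0.
  by exists (f, a, (b, u)); split.
pose f i := (p i).1.1; pose a i := (p i).1.2.
pose sigma i := (p i).2.1; pose u i := (p i).2.2.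
(* The margin in each slice must absorb two losses of [kappa]: one from the tail [t], one from the
   remainder [d]. *)
have [kappa [kappa0 /all_and2[u_le fu]]] : exists kappa, 0 < kappa /\
    forall i, `|u i| <= 1 - kappa /\
      kappa + kappa < f i (l1_inj (sigma i) (u i)) - (1 - a i).
  have : \forall kappa \near 0^'+, forall i, `|u i| <= 1 - kappa /\
      kappa + kappa < f i (l1_inj (sigma i) (u i)) - (1 - a i).
    apply: filter_forall => i; have [_ _ u1 fu _] := Sp i.
    have g0 : 0 < (f i (l1_inj (sigma i) (u i)) - (1 - a i)) / 2.
      by rewrite divr_gt0// subr_gt0.
    have h0 : 0 < 1 - `|u i| by rewrite subr_gt0.
    near=> kappa; split.
      by rewrite lerBrDr addrC -lerBrDr; near: kappa; exact: nbhs_right_le.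
    have : kappa < (f i (l1_inj (sigma i) (u i)) - (1 - a i)) / 2.
      by near: kappa; exact: nbhs_right_lt.
    lra.
  move=> hk; have [kappa [? ?]] := filter_ex (filterI (nbhs_right_gt 0) hk).
  by exists kappa.
have [N [u_head f_tail]] : exists N, (forall i k, (N <= k)%N -> u i k = 0) /\
    forall i (w : l1sum I (c0 R)), (forall b k, (k < N)%N -> w b k = 0) ->
      `|f i w| <= kappa * `|w|.
  have uN : \forall N \near \oo, forall i k, (N <= k)%N -> u i k = 0.
    by apply: filter_forall => i; have [] := Sp i.
  have fN : \forall N \near \oo, forall i (w : l1sum I (c0 R)),
      (forall b k, (k < N)%N -> w b k = 0) -> `|f i w| <= kappa * `|w|.
    by apply: filter_forall => i; exact: l1_c0_dual_tail.
  by have [N [? ?]] := filter_ex (filterI uN fN); exists N.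
have [delta [delta0 delta_le]] : exists delta, 0 < delta /\ forall b,
    0 < comp_weight lambda sigma b ->
    delta + delta <= kappa * comp_weight lambda sigma b.
  have : \forall delta \near 0^'+, forall b,
      0 < comp_weight lambda sigma b ->
      delta + delta <= kappa * comp_weight lambda sigma b.
    apply: filter_forall => b.
    have [b0|b0] := ltP 0 (comp_weight lambda sigma b); last exact: nearW.
    have g0 : 0 < kappa * comp_weight lambda sigma b / 2.
      by rewrite divr_gt0// mulr_gt0.
    near=> delta => _.
    have : delta <= kappa * comp_weight lambda sigma b / 2.
      by near: delta; exact: nbhs_right_le.
    lra.
  move=> hd; have [delta [? ?]] := filter_ex (filterI (nbhs_right_gt 0) hd).
  by exists delta.
pose z0 := spiked lambda sigma u N.
have z01 : unit_ball z0.
  exact: (norm_spiked_le sigma lambda_ge0 lambda_sum kappa0 u_le u_head).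
exists z0; apply/weak_ball_nbhsP => //.
apply: filterS (weak_near_coords z0 N delta0) => w w_near w1.
have [t [d [wE d_le ut_le t_le t0]]] := spiked_decomposition
  lambda_ge0 lambda_sum u_le u_head delta_le w_near.
have d_kappa : `|d| <= kappa.
  by apply: le_trans d_le _; move: w1; rewrite /unit_ball /=; lra.
(* Every point receives the same [d], which the average returns unchanged as the weights sum to
   1. *)
exists (fun i => l1_inj (sigma i) (u i + t (sigma i)) + d); last first.
  under eq_bigr do rewrite scalerDr.
  by rewrite big_split /= -scaler_suml lambda_sum scale1r.
move=> i; have [-> f1 _ _ _] := Sp i; split.
  rewrite /unit_ball /= (le_trans (ler_normD _ _))// norm_l1_inj.
  have := ut_le i; move: w1; rewrite /unit_ball /=; lra.
rewrite -/(f i) -/(a i) linearD !dualD.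
have ft : `|f i (l1_inj (sigma i) (t (sigma i)))| <= kappa.
  have t1 : `|l1_inj (sigma i) (t (sigma i))| <= 1.
    by rewrite norm_l1_inj; have := t_le (sigma i); lra.
  rewrite (le_trans (f_tail i _ _)) ?ler_piMr ?(ltW kappa0)// => b k kN.
  by rewrite l1_injE; case: eqP => // _; exact: t0.
have fd : `|f i d| <= kappa.
  by rewrite (le_trans (dual_le_norm _ _))// f1 mul1r.
move: ft fd (fu i); rewrite !ler_norml => /andP[ft _] /andP[fd _].
lra.
Unshelve. all: by end_near. Qed.

(** * Failure of P1 *)

Section counterexample.
Context {R : realType}.
Local Notation Z := (l1sum bool (c0 R)).

(** If [n] vectors spanned, expanding [n + 1] unit vectors in them would factor the identity matrix
    of size [n + 1] through rank [n]. *)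
Lemma l1_c0_not_finite_dimensional (I : finType) (i : I) :
  ~ finite_dimensional (l1sum I (c0 R)).
Proof.
move=> [n [e eP]].
have /choice[c cP] (k : 'I_n.+1) := eP (l1_inj i (c0_unit k)).
pose C := \matrix_(k < n.+1, j < n) c k j.
pose E := \matrix_(j < n, k < n.+1) (e j i k : R).
have CE : C *m E = 1%:M.
  apply/matrixP => k l; rewrite !mxE.
  have := congr1 (fun z : l1sum I (c0 R) => z i l : R) (cP k).
  rewrite /= l1_injE eqxx c0_unitE l1_sum c0_sum eq_sym => ->.
  by apply: eq_bigr => j _; rewrite !mxE.
have := mxrankM_maxr C E; rewrite CE mxrank1 => /leq_trans/(_ (rank_leq_row _)).
by rewrite ltnn.
Qed.

(** The unit vectors move past every [N], where each functional is small on the unit ball by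
    [l1_c0_dual_tail]. *)
Lemma l1_inj_unit_weak_cvg (I : finType) (i : I) :
  (fun n => l1_inj i (c0_unit n) : l1sum I (c0 R)) @ \oo -->
  (0 : weak (l1sum I (c0 R))).
Proof.
apply: weak_cvg => f; rewrite dual0; apply/cvgrPdist_le => e e0.
apply: filterS (l1_c0_dual_tail f e0) => N fN.
rewrite sub0r normrN; have := fN (l1_inj i (c0_unit N)).
rewrite norm_l1_inj norm_c0_unit mulr1; apply => j k kN.
by rewrite l1_injE; case: eqP => // _; rewrite c0_unitE ltn_eqF.
Qed.

Lemma l1_c0_not_P1 : ~ P1 Z.
Proof.
pose f : dual Z := c0_coord false 0%N.
have g_subproof z : `|(-%R \o sval f) z| <= 1 * `|z|.
  by rewrite /= normrN; exact: c0_coord_subproof.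
pose g : dual Z := bounded_dual g_subproof.
pose x : Z := l1_inj false (c0_unit 0).
have x1 : `|x| = 1 by rewrite norm_l1_inj norm_c0_unit.
have fx : f x = 1 by rewrite /f c0_coordE /x l1_injE eqxx c0_unitE.
have f1 : dual_norm f = 1.
  apply: (@dual_norm_eq1 _ _ f x) => [w||//]; last by rewrite x1.
  by have := c0_coord_subproof false 0 w; rewrite mul1r.
have gx : g (- x) = 1 by rewrite /g bounded_dualE /= linearN opprK.
have g1 : dual_norm g = 1.
  apply: (@dual_norm_eq1 _ _ g (- x)) => [w||//]; last by rewrite normrN x1.
  by have := g_subproof w; rewrite mul1r.
pose h (i : 'I_2) : dual Z := if i == ord0 then f else g.
have h0 : (0 : R) < 2^-1 by rewrite invr_gt0.
pose S (i : 'I_2) : set Z := slice (h i) 2^-1.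
pose C := sum_sets (fun=> 2^-1) S.
have slC : convex_combination_of_slices C.
  exists 2%N, (fun=> 2^-1), S; split => //.
  - by rewrite !big_ord_recl big_ord0; lra.
  - move=> i; exists (h i), 2^-1; split => //.
    by rewrite /h; case: ifP.
have C0 : C 0.
  exists (fun i : 'I_2 => if i == ord0 then x else - x).
    move=> i; rewrite /S /slice /h /unit_ball /=; case: ifP => _.
      by rewrite x1 fx; split; lra.
    by rewrite normrN x1 gx; split; lra.
  by rewrite !big_ord_recl big_ord0 /= addr0 scalerN subrr.
have C_le z : C z -> `|z true| < 1.
  move=> [s sS ->]; rewrite l1_sum (le_lt_trans (ler_norm_sum _ _ _))//.
  (* Membership in either slice takes more than half of the norm for the summand [false], leaving
     less than half for [true]. *)
  have sb i : `|s i true| < 2^-1.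
    have [s1 hs] := sS i; have : 2^-1 < `|s i false|.
      apply: lt_le_trans (c0_le_norm _ 0).
      have : `|h i (s i)| = `|s i false 0%N|.
        by rewrite /h; case: ifP => _ //=; rewrite normrN.
      by move=> <-; apply: lt_le_trans (ler_norm _); lra.
    by move: s1; rewrite /unit_ball /= l1_normE big_bool /=; lra.
  rewrite !big_ord_recl big_ord0 addr0 !l1Z !normrZ !gtr0_norm//.
  have := sb ord0; have := sb (lift ord0 ord0); lra.
move=> /(_ C slC) oC.
have ball0 : unit_ball (0 : Z) by rewrite /unit_ball /= normr0.
have /weak_ball_nbhsP : nbhs (0 : weak_ball Z) C.
  by apply: open_nbhs_nbhs; split.
(* Were [C] a neighbourhood of 0, it would contain a unit vector of the summand [true], against
   [C_le]. *)
move=> /(_ ball0) /(l1_inj_unit_weak_cvg true) [N _ /(_ N (leqnn N))].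
rewrite /unit_ball /= norm_l1_inj norm_c0_unit lexx => /(_ isT) /C_le.
by rewrite l1_injE eqxx norm_c0_unit ltxx.
Qed.

End counterexample.

Theorem corollary2p5 (R : realType) :
  exists Z : completeNormedModType R,
    [/\ ~ finite_dimensional Z, P2 Z & ~ P1 Z].
Proof.
exists (l1sum bool (c0 R)); split.
- exact: (l1_c0_not_finite_dimensional true).
- exact: l1_c0_P2.
- exact: l1_c0_not_P1.
Qed.
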